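(* For every finite poset $P$ with non-empty ground set, $\operatorname{cw}(P)\leq |P|$, where $|P|$ denotes the number of elements of $P$.
   Context: For a finite poset $P$, a family $\mathcal{S}=(S_x:x\in P)$ of sets indexed by the elements of $P$ is an inclusion representation of $P$ if for all $x,y\in P$: $x\le y$ in $P$ if and only if $S_x\subseteq S_y$. The set $\bigcup\mathcal{S}=\bigcup_{x\in P}S_x$ is the ground set of $\mathcal{S}$. The cube height $\operatorname{ch}(P)$ is the least non-negative integer $h$ such that $P$ has an inclusion representation with $|S_x|\le h$ for every $x\in P$. The cube width $\operatorname{cw}(P)$ is the least non-negative integer $w$ such that there is an inclusion representation $\mathcal{S}$ of $P$ with $|\bigcup\mathcal{S}|=w$ and $|S_x|\le\operatorname{ch}(P)$ for every $x\in P$. *)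

(* Defs.v *)
From mathcomp Require Import all_boot all_order.
From mathcomp Require Import boolp.

Set Implicit Arguments.
Unset Strict Implicit.
Unset Printing Implicit Defensive.

(* The sets of a representation live in an arbitrary finite type [T]. Since all
   cardinalities below are bounded, the ground set is always finite, so no
   representation is lost by this choice. [T] may be larger than the ground
   set, which is why the latter is defined as a union and not as [[set: T]]. *)

Definition inclusion_rep (d : Order.disp_t) (P : finPOrderType d) (T : finType)
    (S : P -> {set T}) : Prop :=
  forall x y : P, (x <= y)%O <-> S x \subset S y.

Definition ground_set (d : Order.disp_t) (P : finPOrderType d) (T : finType)
    (S : P -> {set T}) : {set T} :=
  \bigcup_(x : P) S x.

Definition has_rep_of_height (d : Order.disp_t) (P : finPOrderType d)
    (h : nat) : Prop :=
  exists (T : finType) (S : P -> {set T}),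
    inclusion_rep S /\ (forall x : P, #|S x| <= h).

Lemma has_rep_of_height_card (d : Order.disp_t) (P : finPOrderType d) :
  has_rep_of_height P #|P|.
Proof.
exists P, (fun x => [set z : P | (z <= x)%O]); split; last first.
  by move=> x; apply: max_card.
move=> x y; split=> [xy|/subsetP/(_ x)]; last by rewrite !inE Order.POrderTheory.lexx => ->.
by apply/subsetP => z; rewrite !inE => zx; apply: Order.POrderTheory.le_trans zx xy.
Qed.

Lemma ex_rep_of_height (d : Order.disp_t) (P : finPOrderType d) :
  exists h : nat, `[< has_rep_of_height P h >].
Proof. by exists #|P|; apply/asboolP; apply: has_rep_of_height_card. Qed.

Definition cube_height (d : Order.disp_t) (P : finPOrderType d) : nat :=
  ex_minn (ex_rep_of_height P).

Lemma cube_heightP (d : Order.disp_t) (P : finPOrderType d) :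
  has_rep_of_height P (cube_height P) /\
  (forall h : nat, has_rep_of_height P h -> cube_height P <= h).
Proof.
rewrite /cube_height; case: ex_minnP => m /asboolP hm min_m; split=> // h hh.
by apply: min_m; apply/asboolP.
Qed.

Definition has_rep_of_width (d : Order.disp_t) (P : finPOrderType d)
    (w : nat) : Prop :=
  exists (T : finType) (S : P -> {set T}),
    [/\ inclusion_rep S, #|ground_set S| = w
      & forall x : P, #|S x| <= cube_height P].

Lemma ex_rep_of_width (d : Order.disp_t) (P : finPOrderType d) :
  exists w : nat, `[< has_rep_of_width P w >].
Proof.
have [[T [S [repS leS]]] _] := cube_heightP P.
by exists #|ground_set S|; apply/asboolP; exists T, S.
Qed.

Definition cube_width (d : Order.disp_t) (P : finPOrderType d) : nat :=
  ex_minn (ex_rep_of_width P).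

Lemma cube_widthP (d : Order.disp_t) (P : finPOrderType d) :
  has_rep_of_width P (cube_width P) /\
  (forall w : nat, has_rep_of_width P w -> cube_width P <= w).
Proof.
rewrite /cube_width; case: ex_minnP => m /asboolP hm min_m; split=> // w hw.
by apply: min_m; apply/asboolP.
Qed.

(* Main.v *)
(* Let [S] be a representation of height at most [h] with ground set [G], and
   suppose [#|P| < #|G|]. For [A \subset G] let [X A] be the set of [z] such that
   [S z] meets [A]. Then [A = G] satisfies [#|X A| < #|A|]; take a minimal such
   [A], and replace the elements of [A] by the elements of [X A], with [z]
   belonging to the new set of [x] iff [z <= x]. This is again a representation,
   with a smaller ground set. No set has grown: if the principal down-set of [x]
   met [X A] in more than [#|S x :&: A|] elements, then [A :\: S x] would
   contradict the minimality of [A]. *)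
Require Import Defs.
From mathcomp Require Import all_boot all_order.

Set Implicit Arguments.
Unset Strict Implicit.
Unset Printing Implicit Defensive.

Import Order.POrderTheory.

(** Tagging keeps the new points, taken from [P], apart from the surviving points of [T]. *)
Definition disjoint_sum (T1 T2 : finType) (B : {set T1}) (C : {set T2}) :
    {set T1 + T2} :=
  [set s | match s with inl b => b \in B | inr c => c \in C end].

Lemma card_disjoint_sum (T1 T2 : finType) (B : {set T1}) (C : {set T2}) :
  #|disjoint_sum B C| = #|B| + #|C|.
Proof.
rewrite -!sum1dep_card big_sumType /= !sum1_card.
by congr (_ + _); apply: eq_card.
Qed.

Lemma disjoint_sumS (T1 T2 : finType) (B B' : {set T1}) (C C' : {set T2}) :
  disjoint_sum B C \subset disjoint_sum B' C' = (B \subset B') && (C \subset C').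
Proof.
apply/subsetP/andP => [sub | [/subsetP sB /subsetP sC] [b|c]].
- split; apply/subsetP => b bB.
    by have := sub (inl b); rewrite !inE; apply.
  by have := sub (inr b); rewrite !inE; apply.
- by rewrite !inE; apply: sB.
- by rewrite !inE; apply: sC.
Qed.

Section Replacement.
Variables (d : Order.disp_t) (P : finPOrderType d) (T : finType).
Variable S : P -> {set T}.
Hypothesis repS : inclusion_rep S.
Implicit Types (A : {set T}) (x z : P).

Definition meeting A : {set P} := [set z | S z :&: A != set0].

Definition replacement A x : {set P + T} :=
  disjoint_sum [set z in meeting A | (z <= x)%O] (S x :\: A).

(** To recover [x <= y]: if [S x] meets [A], then [x] is a point of its own new set, hence of that
    of [y]; otherwise [S x] lost nothing and lies in [S y :\: A]. *)
Lemma replacement_rep A : inclusion_rep (replacement A).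
Proof.
move=> x y; rewrite /replacement disjoint_sumS; split=> [xy | /andP[sX sS]].
  apply/andP; split; last by apply/setSD/repS.
  by apply/subsetP => z; rewrite !inE => /andP[-> /le_trans ->].
have [xA | xA] := boolP (x \in meeting A).
  by move/subsetP/(_ x): sX; rewrite inE xA lexx inE => /(_ isT) /andP[].
apply/repS; move: xA; rewrite inE negbK setI_eq0 => /setDidPl SxA.
by move: sS; rewrite SxA => /subset_trans; apply; apply: subsetDl.
Qed.

Lemma card_ground_replacement A :
  #|ground_set (replacement A)| <= #|meeting A| + #|ground_set S :\: A|.
Proof.
rewrite -card_disjoint_sum; apply/subset_leq_card/bigcupsP => x _.
rewrite disjoint_sumS setSD ?andbT; last exact: bigcup_sup.
by apply/subsetP => z; rewrite inE => /andP[].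
Qed.

Lemma card_replacement A x :
  (forall B : {set T}, B \proper A -> #|B| <= #|meeting B|) ->
  #|meeting A| < #|A| -> #|replacement A x| <= #|S x|.
Proof.
move=> minA ltA; rewrite card_disjoint_sum -[leqRHS](cardsID A) leq_add2r.
set D := [set z in _ | _].
have [SxA0 | SxA] := eqVneq (S x :&: A) set0.
  (* Here [A :\: S x] is all of [A], so minimality says nothing; but [z <= x] makes [S z] miss [A]
     too, so [D] is empty. *)
  rewrite SxA0 cards0 leqn0 cards_eq0; apply/eqP/setP => z; rewrite !inE.
  apply/negP => /andP[/negP zA /repS /(setSI A)].
  by rewrite SxA0 subset0.
have prA : A :\: S x \proper A.
  by rewrite properE subsetDl subsetD subxx -setI_eq0 setIC.
(* If [z <= x], then [S z] lies in [S x] and cannot meet [A :\: S x]. *)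
have sub : meeting (A :\: S x) \subset meeting A :\: D.
  apply/subsetP => z; rewrite !inE => /set0Pn[t /setIP[tz /setDP[tA tx]]].
  have zA : S z :&: A != set0 by apply/set0Pn; exists t; apply/setIP.
  rewrite zA /= andbT; apply: contra tx => /repS /subsetP; exact.
have leA := leq_trans (minA _ prA) (subset_leq_card sub).
have DA : D \subset meeting A by apply/subsetP => z; rewrite inE => /andP[].
(* Now [#|A| - #|S x :&: A| <= #|meeting A| - #|D|], which with [ltA] gives even
   [#|D| < #|S x :&: A|]. *)
rewrite cardsD [A :&: _]setIC cardsD (setIidPr DA) in leA.
move: leA; rewrite leq_subLR => /(leq_trans ltA).
rewrite -{1}(subnK (subset_leq_card DA)) [ltnLHS]addnC ltn_add2r.
exact: ltnW.
Qed.

End Replacement.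

Theorem theorem1p1 (d : Order.disp_t) (P : finPOrderType d) (P_nonempty : 0 < #|P|) :
  cube_width P <= #|P|.
Proof.
have [[T [S [repS cardG leS]]] minw] := cube_widthP P.
rewrite leqNgt; apply/negP => ltP.
have violG : #|meeting S (ground_set S)| < #|ground_set S|.
  by rewrite cardG (leq_ltn_trans _ ltP) ?max_card.
have [A /minsetP[violA minA] sAG] :=
  @minset_exists _ (fun A => #|meeting S A| < #|A|) _ violG.
have minA' (B : {set T}) : B \proper A -> #|B| <= #|meeting S B|.
  move=> prB; rewrite leqNgt; apply/negP => violB.
  by move: (prB); rewrite (minA B violB (proper_sub prB)) properxx.
have /minw : has_rep_of_width P #|ground_set (replacement S A)|.
  exists (P + T)%type, (replacement S A); split=> //.
    exact: replacement_rep.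
  by move=> x; apply: leq_trans (leS x); apply: card_replacement.
apply/negP; rewrite -ltnNge -cardG.
apply: leq_ltn_trans (card_ground_replacement S A) _.
by rewrite -(cardsID A (ground_set S)) (setIidPr sAG) ltn_add2r.
Qed.
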